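(* Let $\Gamma$ be a finite connected unoriented graph without loops (multiple edges allowed), with vertex set $V(\Gamma)$, and for distinct $i,j\in V(\Gamma)$ let $e_{ij}=e_{ji}\ge 0$ be the number of edges between $i$ and $j$. Let $\underline q=(q_i)_{i\in V(\Gamma)}\in \mathbb{Z}^{V(\Gamma)}$ be arbitrary. Consider the system of equations in the unknowns $(\underline n,\underline e)\in \mathbb{N}^{V(\Gamma)}\times(\mathbb{N}^* )^{V(\Gamma)}$: $$ e_i n_i = q_i+\sum_{j\in V(\Gamma),\, j\leftrightarrow i} e_{ij}n_j\qquad\text{for all } i\in V(\Gamma).$$ Then there exist at most finitely many $\underline n\in\mathbb{N}^{V(\Gamma)}$ which can be extended to a solution $(\underline n,\underline e)$ of this system such that the quadratic form $Q_{(\Gamma,\underline e)}$ is negative definite.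
   Context: $\mathbb{N}=\{0,1,2,\dots\}$ and $\mathbb{N}^*=\mathbb{N}\setminus\{0\}$. For distinct vertices $i,j$, $i\leftrightarrow j$ means that they are connected by at least one edge. For $\underline e=(e_i)_{i\in V(\Gamma)}$, the quadratic form $Q_{(\Gamma,\underline e)}$ on $\mathbb{R}^{V(\Gamma)}$ is $$Q_{(\Gamma,\underline e)}(\underline x)=\sum_{i\in V(\Gamma)}\Big(-e_ix_i^2+\sum_{j\in V(\Gamma),\,j\ne i}e_{ij}x_ix_j\Big).$$ *)

(* Defs.v *)
From HB Require Import structures.
From mathcomp Require Import all_boot all_order all_algebra.
From mathcomp Require Import classical_sets cardinality reals.
Set Implicit Arguments.
Unset Strict Implicit.
Unset Printing Implicit Defensive.
Import Order.TTheory GRing.Theory Num.Theory.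
Local Open Scope ring_scope.

(* Since every edge has a set of exactly two endpoints, edges are unoriented
   and there are no loops; [ends] need not be injective, so multiple edges
   are allowed. *)
Record multigraph := Multigraph {
  vertex : finType;
  edge : finType;
  ends : edge -> {set vertex};
  card_ends : forall a : edge, #|ends a| = 2%N
}.

Definition nb_edges (G : multigraph) (i j : vertex G) : nat :=
  #|[set a : edge G | ends a == [set i; j]]%SET|.

Definition adj (G : multigraph) : rel (vertex G) :=
  fun i j => (i != j) && (0 < nb_edges i j)%N.
Arguments adj : clear implicits.

Definition connected_graph (G : multigraph) : Prop :=
  forall i j : vertex G, connect (adj G) i j.

Definition is_solution (G : multigraph) (q : {ffun vertex G -> int})
    (n e : {ffun vertex G -> nat}) : Prop :=
  [/\ forall i : vertex G, (0 < e i)%N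
    & forall i : vertex G,
        (e i)%:Z * (n i)%:Z
        = q i + \sum_(j | adj G j i) (nb_edges i j)%:Z * (n j)%:Z].

Definition quad_form (R : realType) (G : multigraph)
    (e : {ffun vertex G -> nat}) (x : {ffun vertex G -> R}) : R :=
  \sum_i (- ((e i)%:R * x i ^+ 2)
          + \sum_(j | j != i) (nb_edges i j)%:R * x i * x j).

Definition negative_definite (R : realType) (V : finType)
    (Q : {ffun V -> R} -> R) : Prop :=
  forall x : {ffun V -> R}, x != 0 -> Q x < 0.

(* Main.v *)
(* Write M(e) for the matrix of - Q_e, so that a solution satisfies M(e) n = q.
   By Dickson's lemma finitely many of the e with Q_e negative definite lie
   below all the others.  If e0 <= e is one of them, then M(e0) n <= M(e) n = q
   because n >= 0.  As M(e0) is positive definite with nonpositive off-diagonal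
   entries, it satisfies a comparison principle, whence n <= M(e0)^-1 q.  Thus n
   is bounded by one of finitely many vectors. *)
Require Import Defs.
From HB Require Import structures.
From mathcomp Require Import all_boot all_order all_algebra.
From mathcomp Require Import boolp classical_sets cardinality reals.
Set Implicit Arguments.
Unset Strict Implicit.
Unset Printing Implicit Defensive.
Import Order.TTheory GRing.Theory Num.Theory.
Local Open Scope classical_set_scope.
Local Open Scope ring_scope.

(** Comparing only the coordinates in [S] allows induction on [S]. Adding [a], the list [s] for the
    old coordinates still serves every [e] with [e a] large; the remaining [e] fall into finitely
    many slices of constant [e a], where the induction hypothesis applies to a smaller [P]. *)
Lemma dickson_on (V : finType) (S : seq V) (P : set {ffun V -> nat}) :
  exists2 s : seq {ffun V -> nat}, {in s, forall e, P e} &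
    forall e, P e -> exists2 e0, e0 \in s & {in S, forall i, (e0 i <= e i)%N}.
Proof.
elim: S P => [|a S IH] P.
  have [[e Pe]|nP] := pselect (exists e, P e).
    exists [:: e] => [e'|e' _]; first by rewrite inE => /eqP ->.
    by exists e; rewrite ?inE.
  by exists [::] => // e Pe; case: nP; exists e.
have [s sP sB] := IH P.
(* From this threshold on, [e a] exceeds or equals the [a]-coordinate of every member of [s]. *)
pose N := (\max_(e <- s) e a)%N.
have /choice[t tP] (k : nat) : exists t : seq {ffun V -> nat},
    {in t, forall e, P e /\ e a = k} /\ forall e, P e -> e a = k ->
      exists2 e0, e0 \in t & {in S, forall i, (e0 i <= e i)%N}.
  have [t tP tB] := IH [set e | P e /\ e a = k].
  by exists t; split=> // e Pe ea; apply: tB.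
exists (s ++ flatten [seq t k | k <- iota 0 N]) => [e|e Pe].
  rewrite mem_cat => /orP[/sP//|/flatten_mapP[k _ ek]].
  by case: (tP k) => tk _; case: (tk e ek).
have [Ne|eN] := leqP N (e a).
  have [e0 e0s e0e] := sB e Pe; exists e0; first by rewrite mem_cat e0s.
  move=> i; rewrite inE => /predU1P[->|/e0e//].
  by apply: leq_trans Ne; apply: leq_bigmax_seq.
have [tk tB] := tP (e a).
have [e0 e0t e0e] := tB e Pe erefl; exists e0.
  rewrite mem_cat; apply/orP; right; apply/flatten_mapP.
  by exists (e a) => //; rewrite mem_iota.
move=> i; rewrite inE => /predU1P[->|/e0e//].
by have [_ ->] := tk _ e0t.
Qed.

Lemma dickson (V : finType) (P : set {ffun V -> nat}) :
  exists2 s : seq {ffun V -> nat}, {in s, forall e, P e} &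
    forall e, P e -> exists2 e0, e0 \in s & forall i, (e0 i <= e i)%N.
Proof.
have [s sP sB] := dickson_on (enum V) P; exists s => // e /sB[e0 e0s e0e].
by exists e0 => // i; apply: e0e; rewrite mem_enum.
Qed.

Lemma finite_ffun_le (V : finType) (B : nat) :
  finite_set [set n : {ffun V -> nat} | forall i, (n i <= B)%N].
Proof.
apply: (@sub_finite_set _ _
  ((fun f : {ffun V -> 'I_B.+1} => [ffun i => f i : nat]) @` setT)).
  move=> n nB; exists [ffun i => inord (n i)] => //.
  by apply/ffunP => i; rewrite !ffunE inordK ?ltnS.
exact/finite_image/finite_finset.
Qed.

Section Intersection_operator.
Variables (R : realType) (G : multigraph).
Implicit Types (e : {ffun vertex G -> nat}) (x y z : {ffun vertex G -> R^o}).

(** The operator M(e). Writing [R^o] makes its domain a finite-dimensional vector space. *)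
Definition neg_intersection e x : {ffun vertex G -> R^o} :=
  [ffun i => (e i)%:R * x i - \sum_(j | j != i) (nb_edges i j)%:R * x j].

Lemma neg_intersection_is_linear e : linear (neg_intersection e).
Proof.
move=> a x y; apply/ffunP => i; rewrite !ffunE.
under eq_bigr do rewrite !ffunE mulrDr mulrCA.
by rewrite big_split -mulr_sumr /= mulrDr mulrCA opprD addrACA -mulrBr.
Qed.

HB.instance Definition _ e :=
  GRing.isLinear.Build R {ffun vertex G -> R^o} {ffun vertex G -> R^o} _
    (neg_intersection e) (neg_intersection_is_linear e).

Lemma quad_formE e x :
  quad_form e x = - \sum_i x i * neg_intersection e x i.
Proof.
rewrite -sumrN; apply: eq_bigr => i _; rewrite ffunE mulrBr opprB addrC.
congr (_ - _); last by rewrite expr2 mulrCA.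
by rewrite mulr_sumr; apply: eq_bigr => j _; rewrite -mulrA mulrCA.
Qed.

(** Comparison principle: a nonzero positive part of [z] would contradict definiteness when used as
    a test vector. *)
Lemma neg_intersection_le0 e z :
    negative_definite (@quad_form R G e) ->
    (forall i, neg_intersection e z i <= 0) ->
  forall i, z i <= 0.
Proof.
move=> ndef Lz; pose p : {ffun vertex G -> R^o} := [ffun i => Num.max 0 (z i)].
have zp i : z i <= p i by rewrite ffunE le_max lexx orbT.
have [p0 i|/ndef] := eqVneq p 0.
  by have := zp i; rewrite p0 ffunE.
(* The positive part p satisfies p_i (L p)_i <= p_i (L z)_i, since p and z
   agree where p is nonzero and off-diagonal entries are nonpositive. *)
rewrite quad_formE oppr_lt0 ltNge => /negP[]; apply: sumr_le0 => i _.
have [zi|zi] := leP (z i) 0.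
  by rewrite ffunE max_l// mul0r.
have pi : p i = z i by rewrite ffunE max_r// ltW.
rewrite pi; apply: mulr_ge0_le0 (ltW zi) (le_trans _ (Lz i)).
(* The diagonal entry is folded back to [p i], so that the diagonal terms cancel. *)
rewrite !ffunE -[Num.max _ _](ffunE (fun i => Num.max 0 (z i))) pi.
by rewrite lerD2l lerN2; apply: ler_sum => j _; apply: ler_wpM2l.
Qed.

(** The form vanishes on the kernel, so definiteness gives injectivity, hence surjectivity by
    dimension. *)
Lemma neg_intersection_surj e y :
  negative_definite (@quad_form R G e) -> exists x, neg_intersection e x = y.
Proof.
move=> ndef; pose L := linfun (neg_intersection e).
have /lker0_limgf LT : lker L == 0%VS.
  apply/lker0P => x x'; rewrite !lfunE /= => Lxx'.
  apply/eqP; rewrite -subr_eq0; apply/negPn/negP => /ndef.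
  rewrite quad_formE linearB /= Lxx' subrr big1 ?oppr0 ?ltxx// => i _.
  by rewrite !ffunE mulr0.
have /memv_imgP[x _ ->] : y \in limg L by rewrite LT memvf.
by exists x; rewrite lfunE.
Qed.

Lemma nb_edgesC (i j : vertex G) : nb_edges i j = nb_edges j i.
Proof. by rewrite /nb_edges finset.setUC. Qed.

Lemma solution_neg_intersection (q : {ffun vertex G -> int})
    (n e : {ffun vertex G -> nat}) : is_solution q n e ->
  neg_intersection e [ffun i => (n i)%:R] = [ffun i => (q i)%:~R].
Proof.
move=> [_ sol]; apply/ffunP => i; rewrite !ffunE; apply/eqP.
rewrite subr_eq; apply/eqP; have /(congr1 (fun m : int => m%:~R : R)) := sol i.
rewrite intrM intrD !pmulrn => ->; congr (_ + _).
(* The system sums over neighbours only; the other [j != i] contribute zero since [nb_edges]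
   vanishes there. *)
rewrite rmorph_sum big_mkcond [RHS]big_mkcond; apply: eq_bigr => j _ /=.
rewrite /adj nb_edgesC ffunE; case: eqVneq => //= _.
by case: posnP => [->|_]; rewrite ?mul0r// intrM !pmulrn.
Qed.

Lemma solution_bound (q : {ffun vertex G -> int}) e0 :
    negative_definite (@quad_form R G e0) ->
  exists B : nat, forall n e, is_solution q n e ->
    (forall i, (e0 i <= e i)%N) -> forall i, (n i <= B)%N.
Proof.
move=> ndef; have [y Ly] := neg_intersection_surj [ffun i => (q i)%:~R] ndef.
(* Here [y] is M(e0)^-1 q, which depends on neither [n] nor [e]. *)
exists (\max_i Num.bound `|y i|)%N => n e sol e0e i.
apply: leq_trans (leq_bigmax i).
pose x : {ffun vertex G -> R^o} := [ffun i => (n i)%:R].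
suff : (x - y) i <= 0.
  rewrite !ffunE subr_le0 => niy; rewrite -(ler_nat R).
  exact: le_trans niy (le_trans (ler_norm _) (ltW (archi_boundP (normr_ge0 _)))).
apply: (neg_intersection_le0 ndef) => {}i.
(* With q rewritten as M(e) n, the off-diagonal parts cancel, leaving [e0 i] against [e i], each
   times [n i]. *)
rewrite linearB /= Ly -(solution_neg_intersection sol) !ffunE subr_le0 lerD2r.
by rewrite ler_wpM2r ?ler_nat.
Qed.

End Intersection_operator.

Theorem theorem4p1 (R : realType) (G : multigraph) (hG : connected_graph G)
    (q : {ffun vertex G -> int}) :
  finite_set [set n : {ffun vertex G -> nat} |
    exists2 e : {ffun vertex G -> nat},
      is_solution q n e & negative_definite (@quad_form R G e)].
Proof.
have [s sP sB] := dickson [set e | negative_definite (@quad_form R G e)].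
have [B HB] : exists B : nat, forall e0, e0 \in s -> forall n e,
    is_solution q n e -> (forall i, (e0 i <= e i)%N) -> forall i, (n i <= B)%N.
  (* [sB] is dropped because domination is not inherited by sublists. *)
  elim: s sP {sB} => [|e0 s IH] sP; first by exists 0%N.
  have [|B HB] := IH; first by move=> e es; apply: sP; rewrite inE es orbT.
  have [|B0 HB0] := @solution_bound R G q e0.
    by apply: sP; rewrite mem_head.
  exists (maxn B0 B) => e1; rewrite inE => /predU1P[->|e1s] n e sol le i.
    by rewrite leq_max (HB0 n e).
  by rewrite leq_max (HB e1 e1s n e) ?orbT.
apply: sub_finite_set (finite_ffun_le _ B) => n [e sol /sB[e0 e0s e0e]] i.
exact: HB e0s _ _ sol e0e i.
Qed.
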